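(* Let $\mathcal M$ be a triangulated category that is a module over a tensor triangulated category $(\mathcal K,\otimes,1)$. Let $c:SMod(\mathcal M)\longrightarrow SMod(\mathcal M)$ be an operator that is extensive, order-preserving and of finite type, and let $SMod^c(\mathcal M)=\{\mathcal N\in SMod(\mathcal M) : c(\mathcal N)=\mathcal N\}$. Let $\mathcal N\in SMod^c(\mathcal M)$. Then the function $$f:SMod^c(\mathcal M)\longrightarrow SMod^c(\mathcal M),\qquad \mathcal N'\mapsto c^\infty(\mathcal N+\mathcal N')$$ is a continuous function on the spectral space $SMod^c(\mathcal M)$. In other words, the spectral space $SMod^c(\mathcal M)$ equipped with the operation $(\mathcal N,\mathcal N')\mapsto c^\infty(\mathcal N+\mathcal N')$ is a topological monoid.
   Context: All categories are assumed to be essentially small. A tensor triangulated category $(\mathcal K,\otimes,1)$ is a triangulated category $\mathcal K$ with a symmetric monoidal product $\otimes:\mathcal K\times\mathcal K\to\mathcal K$ that is exact in each variable, with unit object $1$. A triangulated category $\mathcal M$ is a module over $(\mathcal K,\otimes,1)$ (in the sense of Stevenson) if there is a functor (action) $\ast:\mathcal K\times\mathcal M\to\mathcal M$, exact in each variable, together with natural isomorphisms $(a\otimes b)\ast m\cong a\ast(b\ast m)$ and $1\ast m\cong m$ satisfying the usual pentagon and unit coherence conditions, compatible with exactness and with the translation functors $T_{\mathcal K}$, $T_{\mathcal M}$ (in particular $T_{\mathcal K}(a)\ast m\cong T_{\mathcal M}(a\ast m)\cong a\ast T_{\mathcal M}(m)$, with the usual sign $(-1)^{rs}$ in the comparison $T_{\mathcal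 K}^r(1)\ast T_{\mathcal M}^s(m)\cong T_{\mathcal M}^{r+s}(m)$), and distributing over coproducts whenever they exist. A thick $\mathcal K$-submodule of $\mathcal M$ is a full subcategory $\mathcal L\subseteq\mathcal M$ containing $0$ such that: (a) $a\ast m\in\mathcal L$ for all $a\in\mathcal K$, $m\in\mathcal L$; (b) for $m,m'\in\mathcal M$, $m\oplus m'\in\mathcal L$ if and only if both $m,m'\in\mathcal L$; (c) for any distinguished triangle $m'\to m\to m''$ in $\mathcal M$, if two of $m',m,m''$ lie in $\mathcal L$, so does the third. A submodule is thus determined by its objects (and is closed under isomorphism); inclusions, unions and intersections refer to objects. The collection $SMod(\mathcal M)$ of all thick $\mathcal K$-submodules is a set; it is given the topology having the sets $U(m)=\{\mathcal N\in SMod(\mathcal M) : m\in\mathcal N\}$, $m\in\mathcal M$, as a subbasis of open sets, and $SMod^c(\mathcal M)$ has the subspace topology (it is a spectral space, i.e. homeomorphic to the Zariski spectrum of a commutative ring). For $m\in\mathcal M$, $\mathcal K(m)$ denotes the smallest thick $\mathcal K$-submodule containing $m$. For $\mathcal N,\mathcal N'\in SMod(\mathcal M)$, $\mathcal N+\mathcal N'$ denotes the smallest thick $\mathcal K$-submodule containing both $\mathcal N$ and $\mathcal N'$. An operator (map of sets) $c:SMod(\mathcal M)\to SMod(\mathcal M)$ is: extensive if $\mathcal N\subseteq c(\mathcal N)$ for each $\mathcal N$; order-preserving if $\mathcal N\subseteq\mathcal N'$ implies $c(\mathcal N)\subseteq c(\mathcal N')$; of finite type if $c(\mathcal N)=\bigcup_{n\in\mathcal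 N}c(\mathcal K(n))$ for each $\mathcal N$. For such $c$, one sets $c^\infty(\mathcal N):=\bigcup_{i\ge 0}c^i(\mathcal N)$, where $c^i$ is the $i$-fold iterate of $c$ and $c^0$ is the identity; $c^\infty(\mathcal N)$ always lies in $SMod^c(\mathcal M)$. *)

(* Defs.v *)
From HB Require Import structures.
From mathcomp Require Import all_boot all_order all_algebra.
From mathcomp Require Import all_classical topology.

Set Implicit Arguments.
Unset Strict Implicit.
Unset Printing Implicit Defensive.

Import GRing.Theory.
Local Open Scope classical_set_scope.
Local Open Scope ring_scope.

(* A category here has a type of objects and types of morphisms, so it is small
   relative to a large enough universe; this stands for essential smallness. *)
Record preadditive := Preadditive {
  ob :> Type;
  hom : ob -> ob -> zmodType;
  idm : forall a : ob, hom a a;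
  comp : forall {a b c : ob}, hom b c -> hom a b -> hom a c;
  comp1m : forall (a b : ob) (f : hom a b), comp (idm b) f = f;
  compm1 : forall (a b : ob) (f : hom a b), comp f (idm a) = f;
  compA : forall (a b c d : ob) (h : hom c d) (g : hom b c) (f : hom a b),
    comp h (comp g f) = comp (comp h g) f;
  compDl : forall (a b c : ob) (g g' : hom b c) (f : hom a b),
    comp (g + g') f = comp g f + comp g' f;
  compDr : forall (a b c : ob) (g : hom b c) (f f' : hom a b),
    comp g (f + f') = comp g f + comp g f' }.

Arguments comp {_ _ _ _} _ _.
Arguments idm {_} _.
Notation "g \oc f" := (comp g f) (at level 40, left associativity).

Record iso (C : preadditive) (a b : C) := Iso {
  fwd : hom a b;
  bwd : hom b a;
  fwdK : bwd \oc fwd = idm a;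
  bwdK : fwd \oc bwd = idm b }.

Definition is_iso (C : preadditive) (a b : C) (f : hom a b) : Prop :=
  exists i : iso a b, fwd i = f.

Section IsoOps.
Variable C : preadditive.

Definition iso_id (a : C) : iso a a := Iso (comp1m (idm a)) (comp1m (idm a)).

Definition iso_inv (a b : C) (i : iso a b) : iso b a := Iso (bwdK i) (fwdK i).

Lemma iso_compK (a b c : C) (j : iso b c) (i : iso a b) :
  (bwd i \oc bwd j) \oc (fwd j \oc fwd i) = idm a.
Proof. by rewrite compA -(compA (bwd i)) fwdK compm1 fwdK. Qed.

Definition iso_comp (a b c : C) (j : iso b c) (i : iso a b) : iso a c :=
  Iso (iso_compK j i) (iso_compK (iso_inv i) (iso_inv j)).

End IsoOps.

Section Objects.
Variable C : preadditive.

Definition is_zero (z : C) : Prop :=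
  forall a : C, (forall f g : hom a z, f = g) /\ (forall f g : hom z a, f = g).

Definition is_biproduct (a b s : C) : Prop :=
  exists (i1 : hom a s) (i2 : hom b s) (p1 : hom s a) (p2 : hom s b),
    [/\ p1 \oc i1 = idm a, p2 \oc i2 = idm b, p1 \oc i2 = 0, p2 \oc i1 = 0
      & i1 \oc p1 + i2 \oc p2 = idm s].

Definition is_coproduct (I : Type) (x : I -> C) (s : C)
    (inj : forall j, hom (x j) s) : Prop :=
  forall (y : C) (g : forall j, hom (x j) y),
    exists! h : hom s y, forall j, h \oc inj j = g j.

End Objects.

Record functor (C D : preadditive) := Functor {
  fob :> C -> D;
  fmap : forall {a b : C}, hom a b -> hom (fob a) (fob b);
  fmap1 : forall a : C, fmap (idm a) = idm (fob a);
  fmapM : forall (a b c : C) (g : hom b c) (f : hom a b),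
    fmap (g \oc f) = fmap g \oc fmap f }.

Arguments fmap {_ _} _ {_ _} _.

Definition additive (C D : preadditive) (F : functor C D) : Prop :=
  forall (a b : C) (f g : hom a b), fmap F (f + g) = fmap F f + fmap F g.

Definition natural (C D : preadditive) (F G : functor C D)
    (t : forall a : C, iso (F a) (G a)) : Prop :=
  forall (a b : C) (f : hom a b), fwd (t b) \oc fmap F f = fmap G f \oc fwd (t a).

Section FunctorOps.
Variables C D E : preadditive.

Definition functor_id : functor C C :=
  @Functor C C id (fun _ _ f => f) (fun _ => erefl) (fun _ _ _ _ _ => erefl).

Lemma functor_comp1 (G : functor D E) (F : functor C D) (a : C) :
  fmap G (fmap F (idm a)) = idm (G (F a)).
Proof. by rewrite !fmap1. Qed.

Lemma functor_compM (G : functor D E) (F : functor C D) (a b c : C)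
    (g : hom b c) (f : hom a b) :
  fmap G (fmap F (g \oc f)) = fmap G (fmap F g) \oc fmap G (fmap F f).
Proof. by rewrite !fmapM. Qed.

Definition functor_comp (G : functor D E) (F : functor C D) : functor C E :=
  Functor (functor_comp1 G F) (functor_compM G F).

Lemma fmap_isoK (F : functor C D) (a b : C) (i : iso a b) :
  fmap F (bwd i) \oc fmap F (fwd i) = idm (F a).
Proof. by rewrite -fmapM fwdK fmap1. Qed.

Definition fmap_iso (F : functor C D) (a b : C) (i : iso a b) : iso (F a) (F b) :=
  Iso (fmap_isoK F i) (fmap_isoK F (iso_inv i)).

End FunctorOps.

Fixpoint functor_iter (C : preadditive) (F : functor C C) (n : nat) :
    functor C C :=
  if n is p.+1 then functor_comp F (functor_iter F p) else functor_id C.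

(* From H F ~ F' H, the induced comparison H F^n ~ F'^n H. *)
Fixpoint comparison_iter (C D : preadditive) (H : functor C D)
    (F : functor C C) (F' : functor D D)
    (phi : forall a : C, iso (H (F a)) (F' (H a))) (n : nat) (a : C) :
    iso (H (functor_iter F n a)) (functor_iter F' n (H a)) :=
  match n return iso (H (functor_iter F n a)) (functor_iter F' n (H a)) with
  | 0%N => iso_id (H a)
  | p.+1 => iso_comp (fmap_iso F' (comparison_iter phi p a))
                     (phi (functor_iter F p a))
  end.

Record bifunctor (C D E : preadditive) := Bifunctor {
  bob :> C -> D -> E;
  bmap : forall {a a' : C} {b b' : D},
    hom a a' -> hom b b' -> hom (bob a b) (bob a' b');
  bmap1 : forall (a : C) (b : D), bmap (idm a) (idm b) = idm (bob a b);
  bmapM : forall (a a' a'' : C) (b b' b'' : D) (f' : hom a' a'') (f : hom a a')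
      (g' : hom b' b'') (g : hom b b'),
    bmap (f' \oc f) (g' \oc g) = bmap f' g' \oc bmap f g }.

Arguments bmap {_ _ _} _ {_ _ _ _} _ _.

Section PartialFunctors.
Variables (C D E : preadditive) (F : bifunctor C D E).

Lemma fixlM (a : C) (b b' b'' : D) (g' : hom b' b'') (g : hom b b') :
  bmap F (idm a) (g' \oc g) = bmap F (idm a) g' \oc bmap F (idm a) g.
Proof. by rewrite -bmapM compm1. Qed.

Definition fixl (a : C) : functor D E := Functor (bmap1 F a) (@fixlM a).

Lemma fixrM (b : D) (a a' a'' : C) (f' : hom a' a'') (f : hom a a') :
  bmap F (f' \oc f) (idm b) = bmap F f' (idm b) \oc bmap F f (idm b).
Proof. by rewrite -bmapM compm1. Qed.

Definition fixr (b : D) : functor C E := Functor (bmap1 F ^~ b) (@fixrM b).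

End PartialFunctors.

(* The translation functor is an adjoint autoequivalence with a chosen
   quasi-inverse; translation automorphisms are the case where the unit and
   counit are identities. *)
Record triangulated := Triangulated {
  tcat :> preadditive;
  zero_exists : exists z : tcat, is_zero z;
  biproduct_exists : forall a b : tcat, exists s : tcat, is_biproduct a b s;
  shift : functor tcat tcat;
  unshift : functor tcat tcat;
  shift_additive : additive shift;
  shift_unit : forall a : tcat, iso a (unshift (shift a));
  shift_counit : forall a : tcat, iso (shift (unshift a)) a;
  shift_unit_natural :
    @natural tcat tcat (functor_id tcat) (functor_comp unshift shift) shift_unit;
  shift_counit_natural :
    @natural tcat tcat (functor_comp shift unshift) (functor_id tcat) shift_counit;
  shift_triangle : forall a : tcat,
    fwd (shift_counit (shift a)) \oc fmap shift (fwd (shift_unit a))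
    = idm (shift a);
  unshift_triangle : forall a : tcat,
    fmap unshift (fwd (shift_counit a)) \oc fwd (shift_unit (unshift a))
    = idm (unshift a);
  dist : forall {x y z : tcat}, hom x y -> hom y z -> hom z (shift x) -> Prop;
  dist_iso : forall (x y z x' y' z' : tcat)
      (u : hom x y) (v : hom y z) (w : hom z (shift x))
      (u' : hom x' y') (v' : hom y' z') (w' : hom z' (shift x'))
      (i : iso x x') (j : iso y y') (k : iso z z'),
    fwd j \oc u = u' \oc fwd i ->
    fwd k \oc v = v' \oc fwd j ->
    fmap shift (fwd i) \oc w = w' \oc fwd k ->
    dist u v w -> dist u' v' w';
  dist_idm : forall x z : tcat,
    is_zero z -> dist (idm x) (0 : hom x z) (0 : hom z (shift x));
  dist_cone : forall (x y : tcat) (u : hom x y),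
    exists (z : tcat) (v : hom y z) (w : hom z (shift x)), dist u v w;
  dist_rotate : forall (x y z : tcat)
      (u : hom x y) (v : hom y z) (w : hom z (shift x)),
    dist u v w <-> dist v w (- fmap shift u);
  dist_morphism : forall (x y z x' y' z' : tcat)
      (u : hom x y) (v : hom y z) (w : hom z (shift x))
      (u' : hom x' y') (v' : hom y' z') (w' : hom z' (shift x'))
      (f : hom x x') (g : hom y y'),
    dist u v w -> dist u' v' w' -> g \oc u = u' \oc f ->
    exists h : hom z z',
      h \oc v = v' \oc g /\ fmap shift f \oc w = w' \oc h;
  dist_octahedral : forall (x y z x' y' z' : tcat)
      (u : hom x y) (i : hom y z') (p : hom z' (shift x))
      (v : hom y z) (j : hom z x') (q : hom x' (shift y))
      (k : hom z y') (r : hom y' (shift x)),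
    dist u i p -> dist v j q -> dist (v \oc u) k r ->
    exists (f : hom z' y') (g : hom y' x'),
      [/\ dist f g (fmap shift i \oc q), f \oc i = k \oc v, r \oc f = p,
          g \oc k = j & q \oc g = fmap shift u \oc r] }.

Arguments shift {_}.
Arguments unshift {_}.
Arguments dist {_ _ _ _} _ _ _.

Record exact_structure (C D : triangulated) (F : functor C D) := ExactStructure {
  exact_additive : additive F;
  exact_shift : forall a : C, iso (F (shift a)) (shift (F a));
  exact_shift_natural :
    @natural C D (functor_comp F shift) (functor_comp shift F) exact_shift;
  exact_dist : forall (x y z : C)
      (u : hom x y) (v : hom y z) (w : hom z (shift x)),
    dist u v w ->
    dist (fmap F u) (fmap F v) (fwd (exact_shift x) \oc fmap F w) }.

Record biexact (C D E : triangulated) (F : bifunctor C D E) := Biexact {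
  biexact_l : forall b : D, exact_structure (fixr F b);
  biexact_r : forall a : C, exact_structure (fixl F a) }.

Section Comparisons.
Variables (C D E : triangulated) (F : bifunctor C D E) (X : biexact F).

Definition shiftl (a : C) (b : D) : iso (F (shift a) b) (shift (F a b)) :=
  exact_shift (biexact_l X b) a.

Definition shiftr (a : C) (b : D) : iso (F a (shift b)) (shift (F a b)) :=
  exact_shift (biexact_r X a) b.

End Comparisons.

Definition shift_step (C : triangulated) (r : int) : functor C C :=
  if r is Posz _ then shift else unshift.

(* The r-th power of the translation functor, r an integer; note that
   `|Negz n| = n.+1. *)
Definition shift_pow (C : triangulated) (r : int) : functor C C :=
  functor_iter (shift_step C r) `|r|%N.

(* The canonical comparison G T^-1 ~ T^-1 G induced by phi : G T ~ T G. *)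
Definition unshift_comparison (C D : triangulated) (G : functor C D)
    (phi : forall a : C, iso (G (shift a)) (shift (G a))) (a : C) :
    iso (G (unshift a)) (unshift (G a)) :=
  iso_comp (fmap_iso unshift (fmap_iso G (shift_counit a)))
    (iso_comp (fmap_iso unshift (iso_inv (phi (unshift a))))
              (shift_unit (G (unshift a)))).

Definition step_comparison (C D : triangulated) (G : functor C D)
    (phi : forall a : C, iso (G (shift a)) (shift (G a))) (r : int) (a : C) :
    iso (G (shift_step C r a)) (shift_step D r (G a)) :=
  match r return iso (G (shift_step C r a)) (shift_step D r (G a)) with
  | Posz _ => phi a
  | Negz _ => unshift_comparison phi a
  end.

Definition pow_comparison (C D : triangulated) (G : functor C D)
    (phi : forall a : C, iso (G (shift a)) (shift (G a))) (r : int) (a : C) :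
    iso (G (shift_pow C r a)) (shift_pow D r (G a)) :=
  comparison_iter (step_comparison phi r) `|r|%N a.

(* The canonical (unsigned) isomorphism T^r T^s ~ T^(r+s) ~ T^s T^r, built from
   the identity of T T and from the unit and counit. *)
Definition step_swap (C : triangulated) (r s : int) (a : C) :
    iso (shift_step C r (shift_step C s a)) (shift_step C s (shift_step C r a)) :=
  match r, s return
    iso (shift_step C r (shift_step C s a)) (shift_step C s (shift_step C r a))
  with
  | Posz _, Posz _ => iso_id (shift (shift a))
  | Posz _, Negz _ => iso_comp (shift_unit a) (shift_counit a)
  | Negz _, Posz _ => iso_inv (iso_comp (shift_unit a) (shift_counit a))
  | Negz _, Negz _ => iso_id (unshift (unshift a))
  end.

Definition pow_swap (C : triangulated) (r s : int) (a : C) :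
    iso (shift_pow C r (shift_pow C s a)) (shift_pow C s (shift_pow C r a)) :=
  iso_inv (comparison_iter
    (fun b => iso_inv (comparison_iter (step_swap r s) `|s|%N b)) `|r|%N a).

Record tt_category := TTCategory {
  ttcat :> triangulated;
  tens : bifunctor ttcat ttcat ttcat;
  tone : ttcat;
  tens_biexact : biexact tens;
  tassoc : forall a b c : ttcat, iso (tens (tens a b) c) (tens a (tens b c));
  tlunit : forall a : ttcat, iso (tens tone a) a;
  trunit : forall a : ttcat, iso (tens a tone) a;
  tbraid : forall a b : ttcat, iso (tens a b) (tens b a);
  tassoc_natural : forall (a a' b b' c c' : ttcat)
      (f : hom a a') (g : hom b b') (h : hom c c'),
    fwd (tassoc a' b' c') \oc bmap tens (bmap tens f g) h
    = bmap tens f (bmap tens g h) \oc fwd (tassoc a b c);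
  tlunit_natural : forall (a a' : ttcat) (f : hom a a'),
    fwd (tlunit a') \oc bmap tens (idm tone) f = f \oc fwd (tlunit a);
  trunit_natural : forall (a a' : ttcat) (f : hom a a'),
    fwd (trunit a') \oc bmap tens f (idm tone) = f \oc fwd (trunit a);
  tbraid_natural : forall (a a' b b' : ttcat) (f : hom a a') (g : hom b b'),
    fwd (tbraid a' b') \oc bmap tens f g = bmap tens g f \oc fwd (tbraid a b);
  tens_pentagon : forall a b c d : ttcat,
    fwd (tassoc a b (tens c d)) \oc fwd (tassoc (tens a b) c d)
    = bmap tens (idm a) (fwd (tassoc b c d)) \oc fwd (tassoc a (tens b c) d)
      \oc bmap tens (fwd (tassoc a b c)) (idm d);
  tens_triangle : forall a b : ttcat,
    bmap tens (idm a) (fwd (tlunit b)) \oc fwd (tassoc a tone b)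
    = bmap tens (fwd (trunit a)) (idm b);
  tens_hexagon : forall a b c : ttcat,
    fwd (tassoc b c a) \oc fwd (tbraid a (tens b c)) \oc fwd (tassoc a b c)
    = bmap tens (idm b) (fwd (tbraid a c)) \oc fwd (tassoc b a c)
      \oc bmap tens (fwd (tbraid a b)) (idm c);
  tens_symmetry : forall a b : ttcat,
    fwd (tbraid b a) \oc fwd (tbraid a b) = idm (tens a b) }.

Arguments tone {_}.

Record tt_module (K : tt_category) (M : triangulated) := TTModule {
  act : bifunctor K M M;
  act_biexact : biexact act;
  aassoc : forall (a b : K) (m : M), iso (act (tens K a b) m) (act a (act b m));
  aunit : forall m : M, iso (act tone m) m;
  aassoc_natural : forall (a a' b b' : K) (m m' : M)
      (f : hom a a') (g : hom b b') (h : hom m m'),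
    fwd (aassoc a' b' m') \oc bmap act (bmap (tens K) f g) h
    = bmap act f (bmap act g h) \oc fwd (aassoc a b m);
  aunit_natural : forall (m m' : M) (h : hom m m'),
    fwd (aunit m') \oc bmap act (idm tone) h = h \oc fwd (aunit m);
  act_pentagon : forall (a b c : K) (m : M),
    fwd (aassoc a b (act c m)) \oc fwd (aassoc (tens K a b) c m)
    = bmap act (idm a) (fwd (aassoc b c m)) \oc fwd (aassoc a (tens K b c) m)
      \oc bmap act (fwd (tassoc a b c)) (idm m);
  act_unitr : forall (a : K) (m : M),
    bmap act (idm a) (fwd (aunit m)) \oc fwd (aassoc a tone m)
    = bmap act (fwd (trunit a)) (idm m);
  act_unitl : forall (a : K) (m : M),
    fwd (aunit (act a m)) \oc fwd (aassoc tone a m)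
    = bmap act (fwd (tlunit a)) (idm m);
  (* compatibility with exactness and translations: the comparisons
     (T a) * m ~ T (a * m) ~ a * (T m) are natural in both variables, and the
     associator and the unitor commute with them in each variable *)
  act_shiftl_natural : forall (a : K) (m m' : M) (h : hom m m'),
    fwd (shiftl act_biexact a m') \oc bmap act (idm (shift a)) h
    = fmap shift (bmap act (idm a) h) \oc fwd (shiftl act_biexact a m);
  act_shiftr_natural : forall (a a' : K) (m : M) (f : hom a a'),
    fwd (shiftr act_biexact a' m) \oc bmap act f (idm (shift m))
    = fmap shift (bmap act f (idm m)) \oc fwd (shiftr act_biexact a m);
  aassoc_shift1 : forall (a b : K) (m : M),
    fwd (shiftl act_biexact a (act b m)) \oc fwd (aassoc (shift a) b m)
    = fmap shift (fwd (aassoc a b m)) \oc fwd (shiftl act_biexact (tens K a b) m)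
      \oc bmap act (fwd (shiftl (tens_biexact K) a b)) (idm m);
  aassoc_shift2 : forall (a b : K) (m : M),
    fwd (shiftr act_biexact a (act b m))
      \oc bmap act (idm a) (fwd (shiftl act_biexact b m))
      \oc fwd (aassoc a (shift b) m)
    = fmap shift (fwd (aassoc a b m)) \oc fwd (shiftl act_biexact (tens K a b) m)
      \oc bmap act (fwd (shiftr (tens_biexact K) a b)) (idm m);
  aassoc_shift3 : forall (a b : K) (m : M),
    fwd (shiftr act_biexact a (act b m))
      \oc bmap act (idm a) (fwd (shiftr act_biexact b m))
      \oc fwd (aassoc a b (shift m))
    = fmap shift (fwd (aassoc a b m)) \oc fwd (shiftr act_biexact (tens K a b) m);
  aunit_shift : forall m : M,
    fwd (aunit (shift m))
    = fmap shift (fwd (aunit m)) \oc fwd (shiftr act_biexact tone m);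
  (* the two composites T^r 1 * T^s m -> T^s (T^r m) agree up to (-1)^(rs) *)
  act_sign : forall (r s : int) (m : M),
    fwd (pow_swap r s m)
      \oc (fmap (shift_pow M r) (fwd (aunit (shift_pow M s m)))
           \oc fwd (pow_comparison (G := fixr act (shift_pow M s m))
                      (fun a => shiftl act_biexact a (shift_pow M s m)) r tone))
    = (fmap (shift_pow M s)
           (fmap (shift_pow M r) (fwd (aunit m))
            \oc fwd (pow_comparison (G := fixr act m)
                       (fun a => shiftl act_biexact a m) r tone))
         \oc fwd (pow_comparison (G := fixl act (shift_pow K r tone))
                    (shiftr act_biexact (shift_pow K r tone)) s m))
      *~ ((-1) ^ (r * s));
  (* whenever the coproducts on both sides exist, the canonical map is an
     isomorphism *)
  act_coprodl : forall (I : Type) (x : I -> K) (m : M)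
      (s : K) (i : forall j, hom (x j) s)
      (d : M) (k : forall j, hom (act (x j) m) d) (u : hom d (act s m)),
    is_coproduct i -> is_coproduct k ->
    (forall j, u \oc k j = bmap act (i j) (idm m)) -> is_iso u;
  act_coprodr : forall (I : Type) (a : K) (x : I -> M)
      (s : M) (i : forall j, hom (x j) s)
      (d : M) (k : forall j, hom (act a (x j)) d) (u : hom d (act a s)),
    is_coproduct i -> is_coproduct k ->
    (forall j, u \oc k j = bmap act (idm a) (i j)) -> is_iso u }.

Section Submodules.
Variables (K : tt_category) (M : triangulated) (A : tt_module K M).

Record thick (L : set M) : Prop := Thick {
  thick0 : forall z : M, is_zero z -> L z;
  thick_act : forall (a : K) (m : M), L m -> L (act A a m);
  thick_sum : forall m m' s : M, is_biproduct m m' s -> (L s <-> L m /\ L m');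
  thick_tri : forall (m' m m'' : M)
      (u : hom m' m) (v : hom m m'') (w : hom m'' (shift m')),
    dist u v w ->
    [/\ L m' -> L m -> L m'', L m' -> L m'' -> L m & L m -> L m'' -> L m'] }.

Record SMod := SubMod { smod_set :> set M; smod_thick : thick smod_set }.

Lemma smod_eq (N N' : SMod) : smod_set N = smod_set N' -> N = N'.
Proof.
case: N => N tN; case: N' => N' tN' /= eNN'.
by move: tN tN'; rewrite eNN' => tN tN'; rewrite (Prop_irrelevance tN tN').
Qed.

Lemma thick_smallest (S : set M) : thick (smallest thick S).
Proof.
split.
- by move=> z z0 L [tL _]; exact: (thick0 tL).
- by move=> a m Sm L LS; apply: thick_act (Sm L LS); case: LS.
- move=> m m' s mm's; split.
    by move=> Ss; split=> L LS; have [tL _] := LS;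
      have [] := (thick_sum tL mm's).1 (Ss L LS).
  by move=> [Sm Sm'] L LS; have [tL _] := LS; apply/(thick_sum tL mm's);
    split; [exact: Sm | exact: Sm'].
- move=> m' m m'' u v w uvw; split=> S1 S2 L LS; have [tL _] := LS;
    have [h1 h2 h3] := thick_tri tL uvw.
  + by apply: h1; [exact: S1 | exact: S2].
  + by apply: h2; [exact: S1 | exact: S2].
  + by apply: h3; [exact: S1 | exact: S2].
Qed.

Definition smod_gen (S : set M) : SMod := SubMod (thick_smallest S).

Definition smod1 (m : M) : SMod := smod_gen [set m].

Definition smod_add (N N' : SMod) : SMod := smod_gen (N `|` N').

HB.instance Definition _ := gen_eqMixin SMod.
HB.instance Definition _ := gen_choiceMixin SMod.

Definition smod_nbhd (m : M) : set SMod := [set N : SMod | (N : set M) m].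

(* The subbase is indexed by itself: the factory wants a pointed index type,
   which M need not be. *)
HB.instance Definition _ :=
  isSubBaseTopological.Build SMod (range smod_nbhd) id.

Section Operators.
Variable c : SMod -> SMod.

Definition extensive : Prop := forall N : SMod, N `<=` c N.

Definition order_preserving : Prop :=
  forall N N' : SMod, N `<=` N' -> c N `<=` c N'.

Definition finite_type : Prop :=
  forall N : SMod, c N = \bigcup_(n in (N : set M)) c (smod1 n) :> set M.

Definition SModc : set SMod := [set N | c N = N].

Definition opinfty_set (N : SMod) : set M := \bigcup_i iter i c N.

Hypotheses (cext : extensive) (cmono : order_preserving) (cfin : finite_type).

Lemma iter_le (N : SMod) (i j : nat) :
  (i <= j)%N -> iter i c N `<=` iter j c N.
Proof.
move=> /subnK <-; elim: (j - i)%N => [|k IH]; first exact: subset_refl.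
by apply: subset_trans IH _ => /=; exact: cext.
Qed.

Lemma opinfty_thick (N : SMod) : thick (opinfty_set N).
Proof.
have dir m m' : opinfty_set N m -> opinfty_set N m' ->
    exists i, (iter i c N : set M) m /\ (iter i c N : set M) m'.
  move=> [i _ im] [j _ jm']; exists (maxn i j).
  by split; [apply: iter_le im; rewrite leq_maxl
            |apply: iter_le jm'; rewrite leq_maxr].
split.
- by move=> z z0; exists 0%N => //; exact: (thick0 (smod_thick _)).
- by move=> a m [i _ im]; exists i => //; exact: (thick_act (smod_thick _)).
- move=> m m' s mm's; split.
    by move=> [i _ /(thick_sum (smod_thick _) mm's)[]]; split; exists i.
  move=> [/dir h /h[i im]]; exists i => //.
  exact/(thick_sum (smod_thick _) mm's).
- move=> m' m m'' u v w uvw; split=> /dir h /h[i [im1 im2]]; exists i => //;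
    by have [h1 h2 h3] := thick_tri (smod_thick (iter i c N)) uvw; auto.
Qed.

Definition opinfty (N : SMod) : SMod := SubMod (opinfty_thick N).

Lemma opinfty_closed (N : SMod) : SModc (opinfty N).
Proof.
apply: smod_eq; apply/seteqP; split; last exact: cext.
rewrite cfin => m [n [i _ in_] cm]; exists i.+1 => //=.
apply: cmono cm; apply: smallest_sub; first exact: smod_thick.
by move=> _ ->.
Qed.

(* (N, N') |-> c^oo (N + N') as an operation on SMod^c(M) *)
Definition opinfty_add (N N' : SModc) : SModc :=
  exist _ (opinfty (smod_add (val N) (val N')))
    (mem_set (opinfty_closed (smod_add (val N) (val N')))).

End Operators.

End Submodules.

Definition topological_monoid (X : topologicalType) (op : X -> X -> X) : Prop :=
  [/\ associative op,
      exists e : X, left_id e op /\ right_id e op &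
      continuous (fun p : X * X => op p.1 p.2)].

(* Main.v *)
Require Import Defs.
From mathcomp Require Import all_boot all_classical topology.

(** [c^oo (N + N')] is the least [c]-closed submodule containing [N] and [N'],
    which makes the operation an associative one with unit [c^oo 0].  It is
    also the union of the submodules [c^oo (K(n) + K(n'))] for [n] in [N] and
    [n'] in [N']: this union is directed, because [n1 (+) n2] generates both
    [n1] and [n2], so it is a thick submodule, and it is [c]-closed because [c]
    is of finite type.  Hence if [m] lies in [c^oo (N + N')], it lies in some
    [c^oo (K(n) + K(n'))], and the operation maps [U(n) x U(n')] into [U(m)]. *)

Set Implicit Arguments.
Unset Strict Implicit.
Unset Printing Implicit Defensive.

Local Open Scope classical_set_scope.

(** * Generated submodules and the subbasis topology *)

Section SubmoduleTopology.
Context (K : tt_category) (M : triangulated) (A : tt_module K M).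

Lemma smod_gen_le (S : set M) (P : SMod A) : S `<=` P -> smod_gen A S `<=` P.
Proof. by move=> SP; apply: smallest_sub => //; exact: smod_thick. Qed.

Lemma smod1_le (n : M) (P : SMod A) : (P : set M) n -> smod1 A n `<=` P.
Proof. by move=> Pn; apply: smod_gen_le => _ ->. Qed.

Lemma smod1_self (n : M) : smod_set (smod1 A n) n.
Proof. exact: sub_gen_smallest. Qed.

Lemma open_smod_nbhd (m : M) : open (smod_nbhd m : set (SMod A)).
Proof.
exists [set smod_nbhd m]; last by rewrite bigcup_set1.
by move=> _ ->; apply: finI_from1; exists m.
Qed.

(** Subbasic neighbourhoods suffice: a basic open set is a finite intersection of them, and a filter
    is stable under finite intersections. *)
Lemma cvg_smod (F : set_system (SMod A)) (N : SMod A) : Filter F ->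
  (forall m, smod_set N m -> F (smod_nbhd m)) -> F --> N.
Proof.
move=> FF FN W [_ [[B BI <-] [V BV VN]] BW]; apply: filterS BW _.
apply: (@filterS _ F _ V); first by move=> x Vx; exists V.
have [D DI eV] := BI _ BV; move: VN; rewrite -eV => VN.
by apply: filter_bigI => U UD; have := DI _ UD; rewrite inE => -[m _ mU];
  have := VN _ UD; rewrite -mU; exact: FN.
Qed.

End SubmoduleTopology.

(** * The closure [c^oo] and its order properties *)

Section Operation.
Context (K : tt_category) (M : triangulated) (A : tt_module K M).
Context (c : SMod A -> SMod A).
Hypotheses (cext : extensive c) (cmono : order_preserving c).
Hypothesis cfin : finite_type c.

Notation oo := (opinfty cext).
Notation oadd := (opinfty_add cext cmono cfin).

Lemma opinfty_ext (N : SMod A) : N `<=` oo N.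
Proof. by move=> m Nm; exists 0. Qed.

Lemma opinfty_le (N P : SMod A) : SModc c P -> N `<=` P -> oo N `<=` P.
Proof.
move=> cP NP m [i _]; elim: i m => [|i IH]; first exact: NP.
by move=> m /= im; rewrite -cP; exact: (cmono IH).
Qed.

Lemma opinfty_mono (N P : SMod A) : N `<=` P -> oo N `<=` oo P.
Proof.
move=> NP; apply: opinfty_le; first exact: opinfty_closed.
by apply: subset_trans NP _; exact: opinfty_ext.
Qed.

(** Finite type writes [c P] as the union of the [c (smod1 A n)] for [n] in [P], so closedness can
    be tested on single generators. *)
Lemma SModc_finite_type (P : SMod A) :
  (forall n, smod_set P n -> c (smod1 A n) `<=` P) -> SModc c P.
Proof.
move=> cP; apply: smod_eq; apply/seteqP; split; last exact: cext.
by rewrite cfin => m [n Pn]; exact: cP.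
Qed.

Lemma smod_add_mono (N N' P P' : SMod A) :
  N `<=` P -> N' `<=` P' -> smod_add N N' `<=` smod_add P P'.
Proof.
move=> NP NP'; apply: smod_gen_le => m Nm; apply: sub_gen_smallest.
by case: Nm => [/NP|/NP'] ?; [left | right].
Qed.

Definition generated_sum (n n' : M) : SMod A :=
  oo (smod_add (smod1 A n) (smod1 A n')).

Lemma generated_sum_closed (n n' : M) : SModc c (generated_sum n n').
Proof. exact: opinfty_closed. Qed.

Lemma generated_sum_l (n n' : M) : smod_set (generated_sum n n') n.
Proof.
by apply: opinfty_ext; apply: sub_gen_smallest; left; exact: smod1_self.
Qed.

Lemma generated_sum_r (n n' : M) : smod_set (generated_sum n n') n'.
Proof.
by apply: opinfty_ext; apply: sub_gen_smallest; right; exact: smod1_self.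
Qed.

Lemma generated_sum_le (n n' : M) (N N' : SMod A) :
  smod_set N n -> smod_set N' n' ->
  generated_sum n n' `<=` oo (smod_add N N').
Proof.
by move=> Nn Nn'; apply: opinfty_mono; apply: smod_add_mono; exact: smod1_le.
Qed.

Lemma smod1_biproduct (N : SMod A) (n1 n2 : M) :
  smod_set N n1 -> smod_set N n2 -> exists2 n, smod_set N n &
    smod1 A n1 `<=` smod1 A n /\ smod1 A n2 `<=` smod1 A n.
Proof.
move=> N1 N2; have [n n12] := biproduct_exists n1 n2; exists n.
  by apply/(thick_sum (smod_thick N) n12).
have [? ?] := (thick_sum (smod_thick (smod1 A n)) n12).1 (@smod1_self K M A n).
by split; exact: smod1_le.
Qed.

(** * The sum as a directed union *)

Section FiniteGeneration.
Variables N N' : SMod A.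

Definition generated_sums : set M :=
  [set m | exists n n', [/\ smod_set N n, smod_set N' n' &
    smod_set (generated_sum n n') m]].

Lemma generated_sums_directed (m m' : M) :
  generated_sums m -> generated_sums m' -> exists n n',
    [/\ smod_set N n, smod_set N' n', smod_set (generated_sum n n') m &
      smod_set (generated_sum n n') m'].
Proof.
move=> [n1 [n1' [N1 N1' m1]]] [n2 [n2' [N2 N2' m2]]].
have [n Nn [n1n n2n]] := smod1_biproduct N1 N2.
have [n' Nn' [n1n' n2n']] := smod1_biproduct N1' N2'.
exists n, n'; split => //.
  by apply: opinfty_mono m1; exact: smod_add_mono.
by apply: opinfty_mono m2; exact: smod_add_mono.
Qed.

(** Each axiom starts from at most two members; directedness places them in one
    [generated_sum n n'], which is already thick. *)
Lemma generated_sums_thick : thick A generated_sums.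
Proof.
split.
- move=> z z0; exists z, z.
  by split; exact: (thick0 (smod_thick _)).
- move=> a m [n [n' [Nn Nn' m1]]]; exists n, n'; split => //.
  exact: (thick_act (smod_thick _)).
- move=> m m' s mm's; split.
    move=> [n [n' [Nn Nn' /(thick_sum (smod_thick _) mm's)[m1 m2]]]].
    by split; exists n, n'.
  move=> [/generated_sums_directed h /h[n [n' [Nn Nn' m1 m2]]]].
  by exists n, n'; split => //; apply/(thick_sum (smod_thick _) mm's).
- move=> m' m m'' u v w uvw.
  split=> /generated_sums_directed h /h[n [n' [Nn Nn' m1 m2]]];
    exists n, n'; split => //;
    by have [] := thick_tri (smod_thick (generated_sum n n')) uvw; auto.
Qed.

Lemma opinfty_add_generated (m : M) :
  smod_set (oo (smod_add N N')) m -> generated_sums m.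
Proof.
pose W : SMod A := SubMod generated_sums_thick.
apply: (@opinfty_le _ W).
  (* The indices of [w] also serve [x]: [generated_sum n n'] is closed and contains [smod1 A w]. *)
  apply: SModc_finite_type => w [n [n' [Nn Nn' mw]]] x cx; exists n, n'.
  split=> //; rewrite -generated_sum_closed.
  by apply: cmono cx; exact: smod1_le.
(* A zero object lies in both [N] and [N'], so it fills the index left free by an [x] taken from
   only one of them. *)
have [z z0] := zero_exists M.
apply: smod_gen_le => x [Nx|Nx].
  exists x, z; split=> //; first exact: (thick0 (smod_thick _)).
  exact: generated_sum_l.
exists z, x; split=> //; first exact: (thick0 (smod_thick _)).
exact: generated_sum_r.
Qed.

End FiniteGeneration.

(** * Joint continuity *)

Lemma opinfty_add_continuous :
  continuous (fun p : SModc c * SModc c => oadd p.1 p.2).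
Proof.
(* The subspace topology is initial for the inclusion, so continuity is checked in [SMod A]. *)
apply: continuous_comp_initial => -[N N'] /=.
apply: cvg_smod => m /opinfty_add_generated[n [n' [Nn Nn' mn]]].
have U (P : SModc c) k : smod_set (val P) k ->
    nbhs P [set Q : SModc c | smod_set (val Q) k].
  move=> Pk; apply: open_nbhs_nbhs; split=> //.
  by exists (smod_nbhd k) => //; exact: open_smod_nbhd.
exists ([set Q : SModc c | smod_set (val Q) n],
        [set Q : SModc c | smod_set (val Q) n']); first by split; exact: U.
by move=> [Q Q'] [/= Qn Qn']; exact: (generated_sum_le Qn Qn').
Qed.

(** * The monoid laws *)

Lemma SModcP (P : SModc c) : c (val P) = val P.
Proof. by have := set_mem (valP P). Qed.

Lemma opinfty_add_lub (N N' P : SModc c) :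
  smod_set (val (oadd N N')) `<=` val P <->
  smod_set (val N) `<=` val P /\ smod_set (val N') `<=` val P.
Proof.
split=> [h|[NP NP']].
  by split=> m Nm; apply: h; apply: opinfty_ext; apply: sub_gen_smallest;
    [left | right].
apply: opinfty_le; first exact: SModcP.
by apply: smod_gen_le => m []; [exact: NP | exact: NP'].
Qed.

(** Yoneda for a poset: [P := N'] and [P := N] give the two inclusions. With [opinfty_add_lub] it
    turns the monoid laws into propositional tautologies. *)
Lemma SModc_eq (N N' : SModc c) :
  (forall P : SModc c,
    smod_set (val N) `<=` val P <-> smod_set (val N') `<=` val P) -> N = N'.
Proof.
move=> h; apply: val_inj; apply: smod_eq; apply/seteqP.
by split; apply/h.
Qed.

Lemma opinfty_addC : commutative oadd.
Proof.
by move=> N N'; apply: SModc_eq => P; rewrite !opinfty_add_lub; tauto.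
Qed.

Lemma opinfty_addA : associative oadd.
Proof.
by move=> N N' N''; apply: SModc_eq => P; rewrite !opinfty_add_lub; tauto.
Qed.

Definition opinfty_zero : SModc c :=
  exist _ (oo (smod_gen A set0)) (mem_set (opinfty_closed cext cmono cfin _)).

Lemma opinfty_zero_le (P : SModc c) :
  smod_set (val opinfty_zero) `<=` val P.
Proof.
apply: opinfty_le; first exact: SModcP.
exact: smod_gen_le.
Qed.

Lemma opinfty_add0 : left_id opinfty_zero oadd.
Proof.
move=> N; apply: SModc_eq => P; rewrite opinfty_add_lub.
by split=> [[]|] // NP; split=> //; exact: opinfty_zero_le.
Qed.

End Operation.

Theorem proposition3p4 (K : tt_category) (M : triangulated) (A : tt_module K M)
    (c : SMod A -> SMod A)
    (cext : extensive c) (cmono : order_preserving c) (cfin : finite_type c) :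
  (forall N : SModc c,
     continuous (fun N' : SModc c => opinfty_add cext cmono cfin N N')) /\
  topological_monoid (opinfty_add cext cmono cfin).
Proof.
have cont := @opinfty_add_continuous _ _ _ _ cext cmono cfin.
split=> [N N'|].
  apply: (@continuous_comp _ _ _ (fun Q : SModc c => (N, Q))
    (fun p => opinfty_add cext cmono cfin p.1 p.2)); last exact: cont.
  (* The slice at [N] of a box [U x V] around [(N, N')] is [V], since [N] lies in [U]. *)
  move=> W [[U V] /= [UN VN'] UVW]; apply: filterS VN' => Q VQ.
  by apply: UVW; split=> //; exact: nbhs_singleton UN.
split=> //; first exact: opinfty_addA.
exists (opinfty_zero cext cmono cfin); split; first exact: opinfty_add0.
by move=> N; rewrite opinfty_addC opinfty_add0.
Qed.
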